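(* Let $\Delta$ be a positive integer. If $G$ is a $(3,\Delta)$-bipartite graph, then $\chi_s'(G)\le 3\Delta$.
   Context: Graphs are finite, simple and undirected. For positive integers $d_A,d_B$, a $(d_A,d_B)$-bipartite graph is a bipartite graph with a bipartition $(A,B)$ such that every vertex of $A$ has degree at most $d_A$ and every vertex of $B$ has degree at most $d_B$. Two distinct edges see each other if they are adjacent (share an endpoint) or there is an edge of $G$ adjacent to both of them. A strong edge-coloring of $G$ is an assignment of colors to the edges of $G$ such that any two distinct edges that see each other receive different colors (equivalently, each color class is an induced matching). The strong chromatic index $\chi_s'(G)$ is the minimum number of colors in a strong edge-coloring of $G$. *)

(* Defs.v *)
From mathcomp Require Import all_boot.

Set Implicit Arguments.
Unset Strict Implicit.
Unset Printing Implicit Defensive.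

Record sgraph := SGraph {
  vertex :> finType;
  adj : rel vertex;
  adj_sym : symmetric adj;
  adj_irrefl : irreflexive adj }.

Definition degree (G : sgraph) (x : G) : nat := #|[set y | adj x y]|.

Definition bipartition (G : sgraph) (A B : {set G}) : Prop :=
  [/\ A :|: B = [set: G],
      [disjoint A & B] &
      forall x y : G, adj x y ->
        (x \in A) && (y \in B) || (x \in B) && (y \in A)].

(* The parts A and B are allowed to be empty. *)
Definition bipartite_deg (dA dB : nat) (G : sgraph) : Prop :=
  exists A B : {set G},
    [/\ bipartition A B,
        forall x, x \in A -> degree x <= dA &
        forall x, x \in B -> degree x <= dB].

Definition edges (G : sgraph) : {set {set G}} :=
  [set [set p.1; p.2] | p : G * G & adj p.1 p.2].

Definition edge (G : sgraph) := {f : {set G} | f \in edges G}.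

Definition edge_adj (G : sgraph) (f g : edge G) : bool :=
  (f != g) && (val f :&: val g != set0).

Definition sees (G : sgraph) (f g : edge G) : bool :=
  (f != g) &&
  (edge_adj f g || [exists h : edge G, edge_adj h f && edge_adj h g]).

Definition strong_edge_coloring (G : sgraph) (k : nat)
    (c : {ffun edge G -> 'I_k}) : bool :=
  [forall f, forall g, sees f g ==> (c f != c g)].

(* Only genuine edges are colored, so an edgeless graph is 0-colorable. *)
Definition strong_edge_colorable (G : sgraph) (k : nat) : bool :=
  [exists c : {ffun edge G -> 'I_k}, strong_edge_coloring c].

Lemma ex_strong_edge_colorable (G : sgraph) :
  exists k, strong_edge_colorable G k.
Proof.
exists #|{: edge G}|; apply/existsP; exists [ffun f => enum_rank f].
apply/forallP=> f; apply/forallP=> g; apply/implyP=> /andP[neq_fg _].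
by rewrite !ffunE; apply: contra neq_fg => /eqP/enum_rank_inj ->.
Qed.

Definition strong_chromatic_index (G : sgraph) : nat :=
  ex_minn (ex_strong_edge_colorable G).

(* Main.v *)
Require Import Defs.
From mathcomp Require Import all_boot fingroup perm zify.

Set Implicit Arguments.
Unset Strict Implicit.
Unset Printing Implicit Defensive.

(** Split the edges into Delta classes so that the edges at each vertex of B get
    distinct classes, and color each class with 3 private colors.  In class c a
    vertex x of B has at most one edge ux, and the conflicts are the arcs x -> y
    with y another neighbor of u, so out-degrees are at most 2.  If the one-way
    arcs (x -> y but not y -> x) of a class are acyclic, its conflict graph is
    2-degenerate, hence 3-colorable.

    Choose the splitting so that the number of pairs of edges with the same
    class at a common vertex of A is maximal.  Switching two classes at one
    vertex of B then shows that a one-way cycle of class c only visits vertices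
    x whose edge ux is alone in class c at u, while the two other edges uy, uv
    share a class d.  Switching c and d at the successor y of x is neutral: it
    breaks the cycle in class c, and can only create a cycle in class d that
    goes through y or v.  So a smallest set hitting all cycles keeps its size,
    and if it stays minimum the new cycle must enter y or v from a vertex whose
    edge u'p was already in class d and pointed at the pair {y, v} before the
    switch.  Hence u' is a strict descendant of u in the relation "points at a
    pair", which is unchanged below u', and this cannot go on forever. *)

(** * Acyclic relations and greedy coloring with three colors *)

Section FiniteRelations.

Variable W : finType.
Implicit Types (P r : rel W) (X : {set W}).

(** Stands in for directed cycles: a nonempty circular set exists exactly when [P] has a directed
    cycle, and no paths have to be handled. *)
Definition circular P X :=
  [forall x in X, [exists y in X, P y x] && [exists z in X, P x z]].

Lemma circularP P X :
  reflect (forall x, x \in X ->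
             (exists2 y, y \in X & P y x) /\ (exists2 z, z \in X & P x z))
          (circular P X).
Proof.
apply: (iffP forall_inP) => [cX x xX|cX x xX].
  by have /andP[/exists_inP ? /exists_inP ?] := cX x xX.
by have [/exists_inP-> /exists_inP->] := cX x xX.
Qed.

(** Without a source, take a minimal nonempty subset in which every element has a predecessor. An
    element without a successor there could be deleted, so the subset is circular. *)
Lemma source_of_acyclic P X :
    irreflexive P -> (forall Y, circular P Y -> Y = set0) -> X != set0 ->
  exists2 x, x \in X & forall y, y \in X -> ~~ P y x.
Proof.
move=> irrP acP X0.
have [/exists_inP[x xX /forall_inP]|] :=
  boolP [exists x in X, [forall y in X, ~~ P y x]]; first by exists x.
rewrite negb_exists_in => /forall_inP nsrc.
pose p Y := (Y != set0) && [forall x in Y, [exists y in Y, P y x]].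
have pX : p X.
  rewrite /p X0; apply/forall_inP => x /nsrc.
  rewrite negb_forall_in => /exists_inP[y yX]; rewrite negbK => Pyx.
  by apply/exists_inP; exists y.
have [Y /minsetP[/andP[Y0 /forall_inP predY] minY] _] := minset_exists pX.
suff cY : circular P Y by rewrite (acP Y cY) eqxx in Y0.
apply/circularP => x xY; split; first exact/exists_inP/predY.
have [/exists_inP//|] := boolP [exists z in Y, P x z].
rewrite negb_exists_in => /forall_inP nsucc.
have pYx : p (Y :\ x).
  apply/andP; split.
    have /exists_inP[y yY Pyx] := predY x xY; apply/set0Pn; exists y.
    by rewrite !inE yY andbT; apply: contraTneq Pyx => ->; rewrite irrP.
  apply/forall_inP => z /setD1P[zx zY].
  have /exists_inP[y yY Pyz] := predY z zY; apply/exists_inP; exists y => //.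
  by rewrite !inE yY andbT; apply: contraTneq Pyz => ->; apply: nsucc.
by have := minY _ pYx (subD1set Y x) => /setP/(_ x); rewrite !inE eqxx xY.
Qed.

(** All neighbors of [x] inside [X] are out-neighbors, hence at most two: color [X] without [x]
    first, then [x]. *)
Lemma three_coloring r :
    (forall x, #|[set y | r x y]| <= 2) ->
    (forall X, X != set0 ->
       exists2 x, x \in X & forall y, y \in X -> r y x -> r x y) ->
  exists col : W -> 'I_3, forall x y, x != y -> r x y -> col x != col y.
Proof.
move=> outr src.
suff /(_ _ [set: W] erefl)[col colP] : forall n X, #|X| = n ->
    exists col : W -> 'I_3, {in X &, forall x y, x != y -> r x y -> col x != col y}.
  by exists col => x y; apply: colP.
elim=> [|n IHn] X cardX.
  by exists (fun=> ord0) => x y; rewrite (cards0_eq cardX) inE.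
have [|x xX srcx] := src X; first by rewrite -card_gt0 cardX.
have [|col colP] := IHn (X :\ x).
  by move: cardX; rewrite (cardsD1 x) xX => -[].
have [i iP] : exists i, i \notin col @: [set y | r x y].
  apply/existsP; rewrite -negb_forall; apply/negP => /forallP full.
  have : #|'I_3| <= #|col @: [set y | r x y]|.
    by apply: subset_leq_card; apply/subsetP => j _; apply: full.
  by rewrite card_ord leqNgt (leq_ltn_trans (leq_imset_card _ _)) ?ltnS ?outr.
have newP y : r x y -> i != col y.
  by move=> rxy; apply: contraNneq iP => ->; apply: imset_f; rewrite inE.
exists (fun y => if y == x then i else col y) => y z yX zX yz ryz.
have [eyx|yx] := eqVneq y x; have [ezx|zx] := eqVneq z x.
- by rewrite eyx ezx eqxx in yz.
- by apply: newP; rewrite -eyx.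
- by rewrite eq_sym newP // srcx // -ezx.
- by apply: colP => //; apply/setD1P.
Qed.

End FiniteRelations.

(** * Splittings of the edges into classes, their weight, and switches *)

Section Classes.

(* [U] and [W] play the roles of A and B; [f (u, w)] is the class of the edge
   [uw], and is irrelevant unless [E u w]. *)
Variables (U W C : finType) (E : U -> W -> bool).
Hypothesis deg3 : forall u, #|[set w | E u w]| <= 3.
Implicit Types (f g : {ffun U * W -> C}) (u t : U) (w x y z v : W) (c d : C).

Definition proper f :=
  forall w u t, E u w -> E t w -> f (u, w) = f (t, w) -> u = t.

Definition mult f u w c := #|[set x | [&& E u x, x != w & f (u, x) == c]]|.

(** Pairs are ordered, so two edges of equal class at a vertex of [U] count twice. *)
Definition weight f := \sum_u \sum_(w | E u w) mult f u w (f (u, w)).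

Definition optimal f := proper f /\ forall g, proper g -> weight g <= weight f.

Definition switch f w c d :=
  [ffun p => if p.2 == w then tperm c d (f p) else f p].

Lemma switchE f w c d u x :
  switch f w c d (u, x) = if x == w then tperm c d (f (u, x)) else f (u, x).
Proof. by rewrite ffunE. Qed.

Lemma proper_switch f w c d : proper f -> proper (switch f w c d).
Proof.
move=> pf x u t ux tx; rewrite !switchE; case: ifP => _; last exact: pf.
by move=> /perm_inj; apply: pf.
Qed.

Lemma multE f u w c :
  mult f u w c = \sum_(x | E u x && (x != w)) (f (u, x) == c).
Proof.
rewrite /mult -sum1dep_card big_mkcond [RHS]big_mkcond; apply: eq_bigr => x _.
by case: (E u x) => //=; case: (x != w) => //=; case: (f (u, x) == c).
Qed.

Lemma weight_split f u w : E u w ->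
  \sum_(x | E u x) mult f u x (f (u, x)) =
  \sum_(x | E u x && (x != w))
    \sum_(y | (E u y && (y != x)) && (y != w)) (f (u, y) == f (u, x))
  + (mult f u w (f (u, w)) + mult f u w (f (u, w))).
Proof.
move=> uw; rewrite (bigD1 w) //=.
have -> : \sum_(x | E u x && (x != w)) mult f u x (f (u, x)) =
  \sum_(x | E u x && (x != w)) ((f (u, w) == f (u, x)) +
    \sum_(y | (E u y && (y != x)) && (y != w)) (f (u, y) == f (u, x))).
  apply: eq_bigr => x /andP[ux xw]; rewrite multE (bigD1 w) //=.
  by rewrite uw eq_sym.
rewrite big_split /=.
have -> : \sum_(x | E u x && (x != w)) (f (u, w) == f (u, x)) =
          mult f u w (f (u, w)).
  by rewrite multE; apply: eq_bigr => x _; rewrite eq_sym.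
lia.
Qed.

(** Only pairs with an edge at [w] change, each counted twice. The additive form avoids truncated
    subtraction. *)
Lemma weight_switch f w c d :
  weight (switch f w c d) + 2 * \sum_(u | E u w) mult f u w (f (u, w)) =
  weight f + 2 * \sum_(u | E u w) mult f u w (tperm c d (f (u, w))).
Proof.
rewrite /weight !(bigID (fun u => E u w) xpredT) /=.
rewrite (eq_bigr _ (fun u uw => weight_split (switch f w c d) uw)).
rewrite [in RHS](eq_bigr _ (fun u uw => weight_split f uw)).
rewrite !big_split /=.
set a1 := \sum_(i | E i w) _; set b1 := \sum_(i | ~~ E i w) _.
set a2 := \sum_(i | E i w) mult (switch _ _ _ _) _ _ _.
set s2 := \sum_(i | E i w) mult _ _ _ (tperm _ _ _).
have -> : a2 = s2.
  apply: eq_bigr => u uw; rewrite !multE switchE eqxx.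
  by apply: eq_bigr => x /andP[_ /negPf xw]; rewrite switchE xw.
set a3 := \sum_(i | E i w) \sum_(_ | _) _.
have -> : a1 = a3.
  apply: eq_bigr => u uw; apply: eq_bigr => x /andP[_ /negPf xw].
  by apply: eq_bigr => y /andP[_ /negPf yw]; rewrite !switchE xw yw.
set b2 := \sum_(i | ~~ E i w) _.
have -> : b1 = b2.
  apply: eq_bigr => u uw; apply: eq_bigr => x ux.
  have fE y : E u y -> switch f w c d (u, y) = f (u, y).
    by rewrite switchE; case: eqP => // ->; rewrite (negPf uw).
  rewrite !multE fE //; apply: eq_bigr => y /andP[uy _]; by rewrite fE.
lia.
Qed.

Lemma weight_switch1 f w c d a : proper f -> E a w -> f (a, w) = d ->
    (forall b, E b w -> f (b, w) != c) ->
  weight (switch f w c d) + 2 * mult f a w d = weight f + 2 * mult f a w c.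
Proof.
move=> pf aw fa noc; have := weight_switch f w c d.
rewrite !(bigD1 a aw) /= fa tpermR.
set s1 := \sum_(_ | _) _; set s2 := \sum_(_ | _) _; suff -> : s1 = s2 by lia.
apply: eq_bigr => b /andP[bw ba]; rewrite tpermD 1?eq_sym ?noc //.
by apply: contra ba => /eqP fb; rewrite (pf w b a) // fa.
Qed.

Lemma weight_switch2 f w c d a b : proper f -> c != d ->
    E a w -> f (a, w) = d -> E b w -> f (b, w) = c ->
  weight (switch f w c d) + 2 * (mult f a w d + mult f b w c) =
  weight f + 2 * (mult f a w c + mult f b w d).
Proof.
move=> pf cd aw fa bw fb; have := weight_switch f w c d.
have ba : b != a by apply: contraNneq cd => eba; rewrite -fa -fb eba.
have bP : E b w && (b != a) by rewrite bw ba.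
rewrite !(bigD1 a aw) /= !(bigD1 b bP) /= fa fb tpermR tpermL.
set s1 := \sum_(_ | _) _; set s2 := \sum_(_ | _) _; suff -> : s1 = s2 by lia.
apply: eq_bigr => e /andP[/andP[ew ea] eb].
by rewrite tpermD //; apply: contraTneq isT => efe;
  [move: eb; rewrite (pf w e b) ?eqxx // fb | move: ea; rewrite (pf w e a) ?eqxx // fa].
Qed.

(** * Local structure of an optimal splitting *)

Lemma exchange f w c d a : optimal f -> E a w -> f (a, w) = d -> c != d ->
    mult f a w c <= mult f a w d \/
  exists b, [/\ E b w, f (b, w) = c &
                mult f a w c + mult f b w d <= mult f a w d + mult f b w c].
Proof.
move=> [pf maxf] aw fa cd; have := maxf _ (@proper_switch f w c d pf).
have [/existsP[b /andP[bw /eqP fb]]|] := boolP [exists b, E b w && (f (b, w) == c)].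
  move=> le_w; right; exists b; split=> //.
  by have := weight_switch2 pf cd aw fa bw fb; lia.
rewrite negb_exists => /forallP noc; left.
suff : forall b, E b w -> f (b, w) != c.
  by move=> /(weight_switch1 pf aw fa); lia.
by move=> b bw; have := noc b; rewrite bw.
Qed.

Lemma deg3_cases u x y v z : E u x -> E u y -> E u v -> E u z ->
  x != y -> x != v -> y != v -> [\/ z = x, z = y | z = v].
Proof.
move=> ux uy uv uz xy xv yv.
have sub : [set x; y; v] \subset [set w | E u w].
  by apply/subsetP => w; rewrite !inE => /orP[/orP[]|] /eqP->.
have card3 : #|[set x; y; v]| = 3.
  by rewrite setUC cardsU1 cards2 !inE negb_or xy ![v == _]eq_sym xv yv.
have : z \in [set x; y; v].
  have /eqP-> : [set x; y; v] == [set w | E u w].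
    by rewrite eqEcard sub card3 deg3.
  by rewrite inE.
by rewrite !inE => /orP[/orP[]|] /eqP->; [apply: Or31|apply: Or32|apply: Or33].
Qed.

Lemma mult_gt0P f u w c :
  reflect (exists x, [/\ E u x, x != w & f (u, x) = c]) (0 < mult f u w c).
Proof.
rewrite /mult card_gt0; apply: (iffP (set0Pn _)) => [[x]|[x [ux xw fx]]].
  by rewrite inE => /and3P[ux xw /eqP fx]; exists x.
by exists x; rewrite inE ux xw fx eqxx.
Qed.

Lemma mult_le1 f u w c x : E u w -> E u x -> x != w -> f (u, x) != c ->
  mult f u w c <= 1.
Proof.
move=> uw ux xw fx; have [//|] := leqP (mult f u w c) 1.
move=> /card_gt1P[y [z [+ + yz]]]; rewrite !inE.
move=> /and3P[uy yw /eqP fy] /and3P[uz zw /eqP fz].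
have xy : x != y by apply: contraNneq fx => ->; rewrite fy.
have xz : x != z by apply: contraNneq fx => ->; rewrite fz.
by have [] := deg3_cases uy uz uw ux yz yw zw => exy; rewrite exy eqxx in xy xz xw.
Qed.

(* Since [u] has at most three edges, all of them are then in class [c]. *)
Definition full f c u x := [&& E u x, f (u, x) == c & 1 < mult f u x c].

Lemma fullE f c u x y : full f c u x -> E u y -> f (u, y) = c.
Proof.
move=> /and3P[ux /eqP fx m2] uy; have [->//|yx] := eqVneq y x.
apply/eqP; apply: contraLR m2 => fy; rewrite -leqNgt; exact: (mult_le1 ux uy).
Qed.

Lemma full_other f c u x y : full f c u x -> exists2 z, E u z & z != y.
Proof.
move=> /and3P[ux /eqP fx /ltnW/mult_gt0P[z [uz zx _]]].
by have [exy|xy] := eqVneq x y; [exists z; rewrite -?exy|exists x].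
Qed.

(** Moving [uy] into the class of [ux] and [ux'] gains two pairs at [u] and loses none there. By
    optimality the switch at [y] must lose two pairs elsewhere, namely at the vertex [t] whose edge
    [ty] had that class. *)
Lemma pair_full f u x x' y : optimal f -> E u x -> E u x' -> E u y -> x != x' ->
    f (u, x') = f (u, x) -> f (u, y) != f (u, x) ->
  exists t, full f (f (u, x)) t y.
Proof.
move=> of_ ux ux' uy xx' fx' fy; set c := f (u, x); set d := f (u, y).
have xy : x != y by apply: contraNneq fy => ->.
have x'y : x' != y by apply: contraNneq fy => <-; rewrite fx'.
have mc : 1 < mult f u y c.
  by apply/card_gt1P; exists x, x'; rewrite !inE ux ux' xy x'y fx' eqxx.
have md : mult f u y d = 0.
  apply/eqP; rewrite -leqn0 leqNgt; apply/negP => /mult_gt0P[z [uz zy fz]].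
  have [] := deg3_cases ux ux' uy uz xx' xy x'y => ez; subst z.
  - by move/eqP: fy; case; rewrite fz.
  - by move/eqP: fy; case; rewrite -fx' fz.
  - by rewrite eqxx in zy.
have cd : c != d by rewrite eq_sym.
have [|[b [bw fb le_m]]] := exchange of_ uy (erefl d) cd; first lia.
by exists b; rewrite /full bw fb eqxx /=; lia.
Qed.

Definition single f c u x :=
  [&& E u x, f (u, x) == c & [forall y, E u y && (y != x) ==> (f (u, y) != c)]].

Lemma singleP f c u x :
  reflect [/\ E u x, f (u, x) = c & forall y, E u y -> y != x -> f (u, y) != c]
          (single f c u x).
Proof.
apply: (iffP and3P) => [[ux /eqP fx /forallP h]|[ux fx h]]; split=> //.
- by move=> y uy yx; have := h y; rewrite uy yx.
- by apply/eqP.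
- by apply/forallP => y; apply/implyP => /andP[]; apply: h.
Qed.

(* [full f c b v] comes from applying [pair_full] after the (neutral) switch at
   [y], and [full f d b x] from applying it before. *)
Variant token_spec f c u t x y : Prop := TokenSpec v d of
    d != c & v != x & v != y & E u v & f (u, y) = d & f (u, v) = d &
    (forall z, E u z -> [\/ z = x, z = y | z = v]) &
    (forall z, E t z -> z != y -> f (t, z) != d) &
    optimal (switch f y c d) &
    (exists b, full f c b v) & (exists b, full f d b x).

(** Switching [c] and the class [d] of [uy] at [y] gains the pair [ux], [uy] at [u] and loses
    nothing at [t]. By optimality it loses a pair of class [d] at [u], which gives [v], and gains
    nothing at [t]; so it is neutral. *)
Lemma tokenP f c u t x y : optimal f -> single f c u x -> single f c t y ->
  E u y -> x != y -> token_spec f c u t x y.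
Proof.
move=> of_ /singleP[ux fx ax] /singleP[ty fy ay] uy xy.
have [pf maxf] := of_; set d := f (u, y).
have dc : d != c by apply: ax => //; rewrite eq_sym.
have cd : c != d by rewrite eq_sym.
have mtc : mult f t y c = 0.
  apply/eqP; rewrite -leqn0 leqNgt; apply/negP => /mult_gt0P[z [tz zy fz]].
  by have := ay z tz zy; rewrite fz eqxx.
have muc : 0 < mult f u y c by apply/mult_gt0P; exists x.
have mud1 : mult f u y d <= 1 by apply: (mult_le1 uy ux) => //; rewrite fx.
have le_m : mult f u y c + mult f t y d <= mult f u y d.
  have := maxf _ (@proper_switch f y c d pf).
  by have := weight_switch2 pf cd uy (erefl d) ty fy; lia.
have mtd : mult f t y d = 0 by lia.
have /mult_gt0P[v [uv vy fv]] : 0 < mult f u y d by lia.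
have vx : v != x by apply: contraNneq dc => evx; rewrite -fv -fx evx.
have of' : optimal (switch f y c d).
  split=> [|g /maxf/leq_trans->//]; first exact: proper_switch.
  by have := weight_switch2 pf cd uy (erefl d) ty fy; lia.
exists v d => //.
- by move=> z uz; apply: (deg3_cases ux uy uv uz xy); rewrite eq_sym.
- move=> z tz zy; apply/negP => /eqP fz.
  by move: mtd; apply/eqP; rewrite -lt0n; apply/mult_gt0P; exists z.
- have := @pair_full (switch f y c d) u x y v of' ux uy uv xy.
  rewrite !switchE eqxx (negPf xy) (negPf vy) fx -/d tpermR fv => /(_ erefl dc).
  move=> [b fub].
  (* The switch only touches edges at [y], so fullness at [b] carries back to [f] once [b] is not
     adjacent to [y]. *)
  have nby : ~~ E b y.
    apply/negP => bY; have fby := fullE fub bY.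
    have eb : b = u by apply: (of'.1 y) => //; rewrite fby switchE eqxx tpermR.
    case/and3P: fub => _; rewrite eb switchE (negPf vy) fv => /eqP edc.
    by rewrite edc eqxx in dc.
  case/and3P: fub => bv; rewrite switchE (negPf vy) => fb m2.
  exists b; rewrite /full bv fb /=; congr (_ < _): m2.
  apply: eq_card => z; rewrite !inE switchE.
  by have [->|//] := eqVneq z y; rewrite (negPf nby).
- have := @pair_full f u y v x of_ uy uv ux.
  by rewrite eq_sym vy fv fx; apply.
Qed.

(** * Conflict arcs and one-way cycles *)

Definition arc f c x y :=
  [exists u, [&& E u x, f (u, x) == c, E u y & y != x]].

(** A mutual arc into a vertex is also an arc out of it, already counted in the out-degree; so only
    one-way cycles obstruct [three_coloring]. *)
Definition oneway f c x y := arc f c x y && ~~ arc f c y x.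

Lemma arcP f c x y :
  reflect (exists u, [/\ E u x, f (u, x) = c, E u y & y != x]) (arc f c x y).
Proof.
by apply: (iffP existsP) => -[u];
  [move=> /and4P[ux /eqP fx uy yx] | move=> [ux fx uy yx]]; exists u => //;
  apply/and4P; split=> //; apply/eqP.
Qed.

Lemma oneway_irr f c : irreflexive (oneway f c).
Proof. by move=> x; rewrite /oneway andbN. Qed.

(** If [ux] shared its class with [ux'], then [pair_full] at the successor [y] of [x] would give a
    vertex [t] with all edges in class [c]. Every arc leaving [y] runs through [t] and is
    reversible, so [y] has no one-way successor. *)
Lemma circular_single f c X x : optimal f -> circular (oneway f c) X ->
  x \in X -> exists u, single f c u x.
Proof.
move=> of_ /circularP cX xX; have pf := of_.1.
have [_ [y yX /andP[/arcP[u [ux fx uy yx]] nyx]]] := cX x xX.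
exists u; apply/singleP; split=> // x' ux' x'x; apply/negP => /eqP fx'.
have fy : f (u, y) != c.
  apply: contraNneq nyx => fy; apply/arcP; exists u; split=> //.
  by rewrite eq_sym.
have := @pair_full f u x x' y of_ ux ux' uy.
rewrite fx fx' eq_sym => /(_ x'x erefl fy)[t tfull].
have [_ [z zX /andP[/arcP[s [sy fsy sz zy]] /negP[]]]] := cX y yX.
have /and3P[ty /eqP fty _] := tfull.
have est : s = t by apply: (pf y) => //; rewrite fsy.
subst s; apply/arcP; exists t; split=> //; first exact: fullE tfull sz.
by rewrite eq_sym.
Qed.

Lemma circular_token f c X x y : optimal f -> circular (oneway f c) X ->
    x \in X -> y \in X -> oneway f c x y ->
  exists u t, [/\ single f c u x, single f c t y, E u y & x != y].
Proof.
move=> of_ cX /(circular_single of_ cX)[u ux] /(circular_single of_ cX)[t ty].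
move=> /andP[/arcP[s [sx fx sy yx]] _]; exists u, t.
have /singleP[ux' fx' _] := ux.
have esu : s = u by apply: (of_.1 x) => //; rewrite fx.
by subst s; split; rewrite // eq_sym.
Qed.

(** * The relation of pointing at a pair, and the descent along it *)

(** Amounts to exactly two edges of class [c] at [u], one of them [ux]. *)
Definition double f c u x :=
  [&& E u x, f (u, x) == c, ~~ single f c u x & ~~ full f c u x].

(* [u] "points at the pair" of edges of class [c] at [t]. *)
Definition follows f u t :=
  [exists c, exists x, exists y,
     [&& single f c u x, E u y, y != x & double f c t y]].

Lemma followsP f u t :
  reflect (exists c x y, [/\ single f c u x, E u y, y != x & double f c t y])
          (follows f u t).
Proof.
apply: (iffP existsP) => [[c /existsP[x /existsP[y /and4P[]]]]|].
  by exists c, x, y.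
move=> [c [x [y [? ? ? ?]]]]; exists c; apply/existsP; exists x.
by apply/existsP; exists y; apply/and4P.
Qed.

(** The only single edge at [u] is [ux], since [uy] and [uv] share a class. At the other neighbors
    [y] and [v], the edges of class [c] are [ty], which is single, and [bv], which is full; neither
    lies in a pair. *)
Lemma token_nfollows f c u t x y s : optimal f -> single f c u x ->
  single f c t y -> E u y -> x != y -> ~~ follows f u s.
Proof.
move=> of_ ux ty uy xy; have pf := of_.1.
have [v d dc vx vy uv fy fv Nu _ _ [b bv] _] := tokenP of_ ux ty uy xy.
have /singleP[_ fx _] := ux.
apply/followsP => -[c' [x' [y' [/singleP[ux' fx' ax'] uy' y'x' dbl]]]].
have ex' : x' = x.
  have [//|ex'|ex'] := Nu _ ux'; subst x'.
    by have := ax' v uv vy; rewrite fv -fx' fy eqxx.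
  by have := ax' y uy; rewrite eq_sym vy fy -fx' fv eqxx => /(_ isT).
subst x'; have ec : c' = c by rewrite -fx' fx.
rewrite {}ec in dbl; case/and4P: dbl => sy' /eqP fs ns nf.
have [ey'|ey'|ey'] := Nu _ uy'; subst y'.
- by rewrite eqxx in y'x'.
- have /singleP[tY ft _] := ty.
  have est : s = t by apply: (pf y) => //; rewrite fs.
  by rewrite est ty in ns.
- have /and3P[bV /eqP fb _] := bv.
  have esb : s = b by apply: (pf v) => //; rewrite fs.
  by rewrite esb bv in nf.
Qed.

Definition agree f g u := forall x, E u x -> f (u, x) = g (u, x).

Lemma single_agree f g c u x : agree f g u -> single f c u x = single g c u x.
Proof.
move=> fg; rewrite /single; case ux: (E u x) => //=; rewrite fg //.
congr (_ && _); apply: eq_forallb => y; case uy: (E u y) => //=.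
by rewrite fg.
Qed.

Lemma full_agree f g c u x : agree f g u -> full f c u x = full g c u x.
Proof.
move=> fg; rewrite /full; case ux: (E u x) => //=; rewrite fg //.
congr (_ && (_ < _)); apply: eq_card => y; rewrite !inE.
by case uy: (E u y) => //=; rewrite fg.
Qed.

Lemma follows_agree f g u t : agree f g u -> agree f g t ->
  follows f u t = follows g u t.
Proof.
move=> fgu fgt; rewrite /follows; apply: eq_existsb => c.
apply: eq_existsb => x; apply: eq_existsb => y.
rewrite (single_agree _ _ fgu) /double (single_agree _ _ fgt).
rewrite (full_agree _ _ fgt); case ty: (E t y) => //=.
by rewrite fgt.
Qed.

(** Counts the vertices that lead to [u], as the descent runs backwards along [follows]. *)
Definition height f u := #|[set s | connect (follows f) s u]|.

(** Under [g] a [follows] walk ending at [u'] avoids [u] and [t], which follow nothing, so it is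
    also a walk under [f]. Under [f] moreover [u'] follows [u], where [uq] lies in the pair of class
    [d]. Hence whatever leads to [u'] under [g] leads to [u] under [f], and [u] itself drops out of
    the count. *)
Lemma height_switch f c u t x y p q X : optimal f ->
    single f c u x -> single f c t y -> E u y -> x != y ->
    let d := f (u, y) in let g := switch f y c d in
    circular (oneway g d) X -> y \in X -> p \in X -> q \in X ->
    oneway g d p q -> p != y -> E u q -> q != x ->
    (forall v, E u v -> v != x -> p != v) ->
  exists u' t', [/\ single g d u' p, single g d t' q, E u' q, p != q &
                    height g u' < height f u].
Proof.
move=> of_ ux ty uy xy d g cX yX pX qX pq py uq qx pnu.
have pf := of_.1.
have [v d'] := tokenP of_ ux ty uy xy.
rewrite -/d => dc vx vy uv ed'; rewrite -{}ed' {d'} in dc *.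
rewrite -/g => fv Nu nt og fullv fullx.
have [u' [t' [u'p t'q u'q npq]]] := circular_token og cX pX qX pq.
exists u', t'; split=> //.
have /singleP[_ fux aux] := ux; have /singleP[tY fty aty] := ty.
have gE s z : g (s, z) = if z == y then tperm c d (f (s, z)) else f (s, z).
  exact: switchE.
have gty : single g d t y.
  apply/singleP; split=> //; first by rewrite gE eqxx fty tpermL.
  by move=> z tz zy; rewrite gE (negPf zy) nt.
have guv : single g d u v.
  apply/singleP; split=> //; first by rewrite gE (negPf vy).
  move=> z uz zv; rewrite gE; have [ezx|ezy|ezv] := Nu _ uz.
  - by rewrite ezx (negPf xy) fux eq_sym.
  - by rewrite ezy eqxx -/d tpermR eq_sym.
  - by rewrite ezv eqxx in zv.
(* After the switch, [v] and [d] take over at [u] the roles of [x] and [c]. *)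
have nu s : ~~ follows g u s by apply: (token_nfollows _ og guv gty).
(* The arc by which the cycle leaves [y] runs through [t]. *)
have ntg s : ~~ follows g t s.
  have /circularP/(_ y yX)[_ [z zX yz]] := cX.
  have [t1 [s1 [t1y s1z t1z yz']]] := circular_token og cX yX zX yz.
  have /singleP[t1Y gt1 _] := t1y; have /singleP[_ gt _] := gty.
  have <- : t1 = t by apply: (og.1 y) => //; rewrite gt1.
  exact: (token_nfollows _ og t1y s1z).
have /singleP[u'P gu'p _] := u'p.
have u'u : u' != u.
  apply/negP => /eqP eu; subst u'; have [ep|ep|ep] := Nu _ u'P.
  - by move: gu'p; rewrite ep gE (negPf xy) fux => /eqP; rewrite eq_sym (negPf dc).
  - by rewrite ep eqxx in py.
  - by have := pnu v uv vx; rewrite ep eqxx.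
have u't : u' != t.
  apply/negP => /eqP eu; subst u'; have /singleP[_ _ /(_ p u'P py)] := gty.
  by rewrite gu'p eqxx.
(* By properness only [t] and [u] have edges of class [c] or [d] at [y]. *)
have agr s : s != u -> s != t -> agree f g s.
  move=> su st z sz; rewrite gE; case: eqP => // ezy; subst z.
  rewrite tpermD //; apply: contraTneq isT => efs.
    by move/eqP: st => []; apply: (pf y) => //; rewrite fty.
  by move/eqP: su => []; apply: (pf y).
have sub s : connect (follows g) s u' -> connect (follows f) s u'.
  move=> /connectP[r]; elim: r s => [|s' r IHr] s /=; first by move=> _ ->.
  move=> /andP[ss' pr] lst; apply: connect_trans (IHr _ pr lst).
  have nut s0 s1 : follows g s0 s1 -> (s0 != u) && (s0 != t).
    move=> fo; apply/andP; split; apply: contraTneq fo => ->;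
    [exact: nu|exact: ntg].
  have /andP[su st] := nut _ _ ss'.
  have /andP[s'u s't] : (s' != u) && (s' != t).
    case: r pr lst {IHr} => [_ /= <-|s'' r /andP[/nut]]; last by [].
    by rewrite u'u.
  apply: connect1; rewrite (follows_agree (g := g)) //; exact: agr.
have fu'u : follows f u' u.
  apply/followsP; exists d, p, q; split=> //.
  - by rewrite (single_agree (g := g)) //; apply: agr.
  - by rewrite eq_sym.
  - have fq : f (u, q) = d.
      by have [eq|->|->] := Nu _ uq => //; rewrite eq eqxx in qx.
    apply/and4P; split=> //; first exact/eqP.
      apply/singleP => -[_ _ aq]; have [yq|yq] := eqVneq y q.
        by have := aq v uv; rewrite -yq vy fv eqxx => /(_ isT).
      by have := aq y uy yq; rewrite eqxx.
    apply/negP => uq'; have := fullE uq' (x := q) (y := x).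
    have /singleP[ux' _ _] := ux; rewrite fux => /(_ ux') ecd.
    by rewrite ecd eqxx in dc.
apply/proper_card/properP; split.
  apply/subsetP => s; rewrite !inE => /sub su'.
  exact: connect_trans su' (connect1 fu'u).
exists u; rewrite !inE ?connect0 //; apply/negP => /connectP[[|s r] /=].
  by move=> _ eu; rewrite eu eqxx in u'u.
by rewrite (negPf (nu s)).
Qed.


(** * Sets that hit all one-way cycles *)

(** Classes enter an arc only through the edges at its tail. *)
Lemma arc_switch f c d y e a b : (e != c) && (e != d) || (a != y) ->
  arc (switch f y c d) e a b = arc f e a b.
Proof.
move=> hyp; apply: eq_existsb => u; rewrite switchE.
have [eay|//] := eqVneq a y.
move: hyp; rewrite eay eqxx orbF => /andP[ec ed].
by rewrite (can2_eq (tpermK c d) (tpermK c d)) tpermD 1?eq_sym.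
Qed.

Lemma circular_switch f c d y e (X : {set W}) : (e != c) && (e != d) || (y \notin X) ->
  circular (oneway (switch f y c d) e) X = circular (oneway f e) X.
Proof.
move=> hyp; have owE a b : a \in X -> b \in X ->
      oneway (switch f y c d) e a b = oneway f e a b.
  move=> aX bX; have nX z : z \in X -> (e != c) && (e != d) || (z != y).
    by case/orP: hyp => [->//|yX zX]; rewrite (memPn yX) ?orbT.
  by rewrite /oneway !arc_switch ?nX.
apply: eq_forallb_in => x xX; congr andb; apply: eq_existsb => z;
  by case zX: (z \in X) => //=; rewrite owE.
Qed.

(** In particular [hits f set0] says that every class is free of one-way cycles. *)
Definition hits f (Y : {set C * W}) :=
  [forall c, forall X : {set W}, circular (oneway f c) X && (X != set0) ==>
     [exists x in X, (c, x) \in Y]].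

Lemma hitsP f (Y : {set C * W}) :
  reflect (forall c X, circular (oneway f c) X -> X != set0 ->
             exists2 x, x \in X & (c, x) \in Y)
          (hits f Y).
Proof.
apply: (iffP forallP) => [h c X cX X0|h c].
  by have /forallP/(_ X) := h c; rewrite cX X0 => /exists_inP.
by apply/forallP => X; apply/implyP => /andP[cX /(h c X cX)/exists_inP].
Qed.

(** A cycle missed by [Z] can meet [Y] only in [(c, y)], so it has class [c] and passes through
    [y]. *)
Lemma nhits f (Y Z : {set C * W}) c y : hits f Y -> ~~ hits f Z ->
    Y \subset (c, y) |: Z ->
  exists X, [/\ circular (oneway f c) X, y \in X &
                forall x, x \in X -> (c, x) \notin Z].
Proof.
move=> /hitsP hY nZ sYZ; move: nZ; rewrite negb_forall => /existsP[e].
rewrite negb_forall => /existsP[X]; rewrite negb_imply negb_exists_in.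
move=> /andP[/andP[cX X0] /forall_inP nX].
have [x xX /(subsetP sYZ)] := hY e X cX X0.
rewrite !inE (negPf (nX x xX)) orbF => /eqP[? ?]; subst x e.
by exists X.
Qed.

(** After the switch the edge of class [c] at [y] is [uy], not alone because of [ux], so no one-way
    cycle of class [c] passes through [y]. Those of class [d] through [y] meet the new element; all
    others existed before and are still hit. *)
Lemma hits_switch f c u t x y (Y : {set C * W}) : optimal f ->
    single f c u x -> single f c t y -> E u y -> x != y -> hits f Y ->
  hits (switch f y c (f (u, y))) ((f (u, y), y) |: (Y :\ (c, y))).
Proof.
move=> of_ ux ty uy xy hY.
have [v d dc vx vy uv fuy fv Nu nt og _ _] := tokenP of_ ux ty uy xy.
rewrite fuy.
apply/hitsP => e X cX X0.
have [yX|yX] := boolP (y \in X).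
  have [->|ed] := eqVneq e d; first by exists y; rewrite ?setU11.
  have [ec|ec] := eqVneq e c; last first.
    move: (cX); rewrite circular_switch ?ec ?ed // => cX'.
    have [z zX zY] := hitsP _ _ hY e X cX' X0; exists z => //.
    by rewrite !inE zY !xpair_eqE (negPf ec) orbT.
  subst e; have [s /singleP[sy gsy asy]] := circular_single og cX yX.
  have /singleP[ux' fux _] := ux.
  have gu : switch f y c d (u, y) = c by rewrite switchE eqxx fuy tpermR.
  have esu : s = u by apply: (og.1 y) => //; rewrite gu.
  subst s; have := asy x ux' xy.
  by rewrite switchE (negPf xy) fux eqxx.
move: (cX); rewrite circular_switch ?yX ?orbT // => cX'.
have [z zX zY] := hitsP _ _ hY e X cX' X0; exists z => //.
by rewrite !inE zY !xpair_eqE (negPf (memPn yX z zX)) !andbF.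
Qed.

(* Lexicographic descent on the size of [Y], then on the height of the vertex of
   [U] whose arc enters an element of [Y]. *)
Lemma acyclic_optimal_exists f (Y : {set C * W}) : optimal f -> hits f Y ->
  exists2 g, optimal g & hits g set0.
Proof.
have [n] := ubnP #|Y|; elim: n f Y => // n IHn f Y.
have small g Z p : optimal g -> hits g (Z :\ p) -> p \in Z -> #|Z| < n.+1 ->
    exists2 g, optimal g & hits g set0.
  move=> og hZ pZ; rewrite (cardsD1 p) pZ => leZ.
  exact: (IHn g _ _ og hZ).
have descend k g Z c u t x y : height g u < k -> optimal g -> hits g Z ->
    #|Z| < n.+1 -> (c, y) \in Z -> single g c u x -> single g c t y ->
    E u y -> x != y -> exists2 g, optimal g & hits g set0.
  elim: k g Z c u t x y => // k IHk g Z c u t x y leh og hZ leZ cyZ ux ty uy xy.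
  have [v d] := tokenP og ux ty uy xy.
  move=> dc vx vy uv gy gv Nu _ oh _ [b bx].
  have hY := hits_switch og ux ty uy xy hZ.
  have hgt := height_switch og ux ty uy xy.
  rewrite /= gy in hY hgt oh; set h := switch g y c d in oh hY hgt *.
  have card1 p : #|p |: Z :\ (c, y)| < n.+1.
    apply: leq_ltn_trans leZ; rewrite (cardsD1 (c, y) Z) cyZ cardsU1.
    by rewrite leq_add2r; case: (_ \notin _).
  (* Here [q] is [y] or [v] and [p] is neither: the arc enters the pair from outside, and the
     descent continues with [(d, q)] at a smaller height. *)
  have next X p q : circular (oneway h d) X -> y \in X -> p \in X -> q \in X ->
      oneway h d p q -> p != y -> p != v -> E u q -> q != x ->
      hits h ((d, q) |: Z :\ (c, y)) -> exists2 g, optimal g & hits g set0.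
    move=> cX yX pX qX pq py pv uq qx hq.
    have [|u' [t' [u'p t'q u'q npq lt]]] := hgt p q X cX yX pX qX pq py uq qx.
      by move=> z uz; have [->|->|->] := Nu z uz; rewrite ?eqxx.
    apply: (IHk h _ d u' t' p q _ oh hq (card1 _) (setU11 _ _)) => //.
    exact: leq_trans lt leh.
  (* Try [(d, v)] in place of [(d, y)]. If this fails, a missed cycle passes through [y] but not
     [v], so its arc into [y] comes from outside the pair. *)
  have [hv|nhv] := boolP (hits h ((d, v) |: Z :\ (c, y))); last first.
    have [|X [cX yX nX]] := nhits (c := d) (y := y) hY nhv.
      by apply/setUS/subsetUr.
    have [[p pX py] _] := circularP _ _ cX y yX.
    apply: (next X p y) => //.
    - by apply: contraTneq py => ->; rewrite oneway_irr.
    - by apply: contraTneq pX => ->; apply/negP => /nX; rewrite setU11.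
    - by rewrite eq_sym.
  have vZ : (d, v) \in (d, v) |: Z :\ (c, y) by rewrite setU11.
  have [/small|nhv] := boolP (hits h (((d, v) |: Z :\ (c, y)) :\ (d, v))).
    by apply.
  have [|X [cX vX nX]] := nhits (c := d) (y := v) hv nhv.
    by rewrite setD1K.
  have huv : h (u, v) = d by rewrite switchE (negPf vy).
  have avy : arc h d v y by apply/arcP; exists u; rewrite eq_sym.
  have [[p pX pv] [z zX /andP[/arcP[s [sv hsv sz zv]] _]]] := circularP _ _ cX v vX.
  have esu : s = u by apply: (oh.1 v) => //; rewrite huv.
  (* The successor of [v] cannot be [x]: the edge of class [d] at [x] is [bx], and all edges of [b]
     keep class [d], whereas on a cycle such an edge is single. *)
  subst s; have yX : y \in X.
    have [ezx|<-//|ezv] := Nu z sz; last by rewrite ezv eqxx in zv.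
    subst z; have [s /singleP[sx hsx asx]] := circular_single oh cX zX.
    have nby : ~~ E b y.
      apply/negP => bY; have gby := fullE bx bY.
      have ebu : b = u by apply: (og.1 y) => //; rewrite gby gy.
      have /singleP[_ gux _] := ux; have /and3P[_ /eqP gbx _] := bx.
      by rewrite -gbx ebu gux eqxx in dc.
    have hb w : E b w -> h (b, w) = d.
      move=> bw; rewrite switchE; have [ew|_] := eqVneq w y.
        by rewrite ew (negPf nby) in bw.
      exact: fullE bx bw.
    have /and3P[bX _ _] := bx.
    have esb : s = b by apply: (oh.1 x) => //; rewrite hb.
    subst s; have [w bw wx] := full_other x bx.
    by have := asx w bw wx; rewrite hb ?eqxx.
  apply: (next X p v) => //.
  (* As [v -> y] is an arc, [y -> v] is not one-way; so the predecessor of [v] lies outside the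
     pair. *)
  - by apply: contraTneq pv => ->; rewrite /oneway avy andbF.
  - by apply: contraTneq pv => ->; rewrite oneway_irr.
move=> leY of_ hY; have [Y0|[[c y] cyY]] := set_0Vmem Y.
  by exists f => //; rewrite -Y0.
have [/small|nh] := boolP (hits f (Y :\ (c, y))); first by apply.
have [|X [cX yX _]] := nhits (c := c) (y := y) hY nh; first by rewrite setD1K.
have [[x xX xy] _] := circularP _ _ cX y yX.
have [u [t [ux ty uy nxy]]] := circular_token of_ cX xX yX xy.
exact: (descend _ _ _ _ _ _ _ _ (leqnn _) of_ hY leY cyY ux ty uy nxy).
Qed.

(** * Existence of an optimal splitting, and the coloring it yields *)

Hypothesis degC : forall w, #|[set u | E u w]| <= #|C|.

Lemma proper_exists (c0 : C) : exists f, proper f.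
Proof.
pose N w := enum [pred u | E u w].
(* The edges at [w] are numbered by the position of their other end in [N w]; on edges the default
   [c0] is never reached. *)
exists [ffun p => nth c0 (enum C) (index p.1 (N p.2))] => w u t uw tw.
have ltN s : E s w -> index s (N w) < size (enum C).
  move=> sw; rewrite -cardE; apply: leq_trans (degC w).
  by rewrite cardsE cardE index_mem mem_enum.
rewrite !ffunE /= => /eqP; rewrite nth_uniq ?enum_uniq ?ltN // => /eqP eqi.
have sN s : E s w -> s \in N w by rewrite mem_enum.
by rewrite -(nth_index u (sN u uw)) eqi nth_index ?sN.
Qed.

Lemma optimal_exists (c0 : C) : exists f, optimal f.
Proof.
have [f0 pf0] := proper_exists c0.
pose properb f := [forall w, forall u, forall t,
  [&& E u w, E t w & f (u, w) == f (t, w)] ==> (u == t)].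
have properP f : reflect (proper f) (properb f).
  apply: (iffP forallP) => [pf w u t uw tw fut|pf w].
    by have /forallP/(_ u)/forallP/(_ t) := pf w; rewrite uw tw fut eqxx => /eqP.
  apply/forallP => u; apply/forallP => t; apply/implyP => /and3P[uw tw /eqP fut].
  exact/eqP/(pf w).
case: (arg_maxnP weight (introT (properP f0) pf0)) => f /properP pf maxf.
by exists f; split=> // g /properP/maxf.
Qed.

Lemma arc_outdegree f c x : proper f -> #|[set y | arc f c x y]| <= 2.
Proof.
move=> pf; have [/existsP[u /andP[ux /eqP fx]]|nu] :=
  boolP [exists u, E u x && (f (u, x) == c)].
  have := deg3 u; rewrite (cardsD1 x) inE ux ltnS; apply: leq_trans.
  apply: subset_leq_card; apply/subsetP => y; rewrite !inE.
  move=> /arcP[t [tx ft ty yx]]; rewrite yx.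
  by have -> : u = t by apply: (pf x) => //; rewrite fx.
suff -> : [set y | arc f c x y] = set0 by rewrite cards0.
apply/setP => y; rewrite !inE.
apply: contraNF nu => /arcP[u [ux fx _ _]].
by apply/existsP; exists u; rewrite ux fx eqxx.
Qed.

(** The color is the class together with the color of the [W]-end in that class. Two edges of equal
    class joined by [uz] give an arc from [w] to [z], or coincide by properness if [w] is [z]. *)
Lemma incidence_coloring (c0 : C) : exists col : U -> W -> C * 'I_3,
  forall u w t z, E u w -> E t z -> E u z -> (u, w) != (t, z) ->
    col u w != col t z.
Proof.
have [f of_] := optimal_exists c0.
have hT : hits f setT.
  by apply/hitsP => c X _ /set0Pn[x xX]; exists x; rewrite ?inE.
have [g og hg] := acyclic_optimal_exists of_ hT.
have acyc c X : circular (oneway g c) X -> X = set0.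
  move=> cX; apply: contraTeq isT => X0.
  by have [x _] := hitsP _ _ hg c X cX X0; rewrite inE.
have colc c : exists col : {ffun W -> 'I_3},
    [forall x, forall y, (x != y) && arc g c x y ==> (col x != col y)].
  have [x|X X0|col colP] := @three_coloring W (arc g c).
  - exact: arc_outdegree og.1.
  - have [x xX src] := source_of_acyclic (@oneway_irr g c) (acyc c) X0.
    exists x => // y /src; rewrite negb_and => /orP[/negPf->//|].
    by rewrite negbK.
  exists (finfun col); apply/forallP => x; apply/forallP => y.
  by apply/implyP => /andP[xy /colP]; rewrite !ffunE; apply.
pose col c := xchoose (colc c).
have colP c x y : x != y -> arc g c x y -> col c x != col c y.
  move=> xy axy; have /forallP/(_ x)/forallP/(_ y) := xchooseP (colc c).
  by rewrite xy axy.
exists (fun u w => (g (u, w), col (g (u, w)) w)) => u w t z uw tz uz.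
apply: contraNneq => -[eg ecol]; have [ewz|wz] := eqVneq w z.
  by move: tz eg; rewrite -ewz => tw eg; rewrite (og.1 w u t).
suff : col (g (u, w)) w != col (g (u, w)) z by rewrite ecol eg eqxx.
apply: colP => //; apply/arcP; exists u; split=> //; by rewrite eq_sym.
Qed.

End Classes.

(** * From incidences back to the edges of the graph *)

Theorem theorem1p5 (Delta : nat) (Delta_gt0 : 0 < Delta) (G : sgraph)
    (hG : bipartite_deg 3 Delta G) :
  strong_chromatic_index G <= 3 * Delta.
Proof.
have [A [B [[AB dAB bip] degA degB]]] := hG.
pose E (u w : G) := (u \in A) && adj u w.
have nAB x : x \in A -> x \in B -> False.
  by move=> xA xB; have := disjointFr dAB xA; rewrite xB.
have EB u w : E u w -> w \in B.
  by move=> /andP[uA /bip/orP[/andP[]//|/andP[uB _]]]; case: (nAB u).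
have deg3 u : #|[set w | E u w]| <= 3.
  have [uA|uA] := boolP (u \in A).
    by apply: leq_trans (degA u uA); apply/subset_leq_card/subsetP => w;
      rewrite !inE => /andP[].
  rewrite (_ : [set w | E u w] = set0) ?cards0 //.
  by apply/setP => w; rewrite !inE /E (negPf uA).
have degD w : #|[set u | E u w]| <= #|'I_Delta|.
  rewrite card_ord; have [wB|wB] := boolP (w \in B).
    by apply: leq_trans (degB w wB); apply/subset_leq_card/subsetP => u;
      rewrite !inE adj_sym => /andP[].
  rewrite (_ : [set u | E u w] = set0) ?cards0 //.
  by apply/setP => u; rewrite !inE; apply: contraNF wB => /EB.
have [col colP] := incidence_coloring deg3 degD (Ordinal Delta_gt0).
(* Edges are unordered sets; each is given ordered ends, the one in [A] first. *)
have edgeP (e : edge G) : exists p : G * G, E p.1 p.2 && (val e == [set p.1; p.2]).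
  case: e => e /= /imsetP[[x y] xy ->] /=; rewrite inE /= in xy.
  have [/andP[xA yB]|/andP[xB yA]] := orP (bip x y xy).
    by exists (x, y); rewrite /E xA xy eqxx.
  by exists (y, x); rewrite /E yA adj_sym xy setUC eqxx.
pose ends e := xchoose (edgeP e).
have endsE e : E (ends e).1 (ends e).2 by have /andP[] := xchooseP (edgeP e).
have valE e : val e = [set (ends e).1; (ends e).2].
  by have /andP[_ /eqP] := xchooseP (edgeP e).
have ends_inj e g : ends e = ends g -> e = g.
  by move=> eg; apply: val_inj; rewrite !valE eg.
have meet e g : val e :&: val g != set0 ->
    (ends e).1 = (ends g).1 \/ (ends e).2 = (ends g).2.
  have [/andP[eA _] /EB eB] := (endsE e, endsE e).
  have [/andP[gA _] /EB gB] := (endsE g, endsE g).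
  move=> /set0Pn[x]; rewrite !valE !inE.
  move=> /andP[/orP[]/eqP-> /orP[]/eqP exg]; try by [left|right].
  - by case: (nAB (ends e).1); rewrite // exg.
  - by case: (nAB (ends g).1); rewrite // -exg.
(* Either the two edges share an end, or the edge between them joins the [A]-end of one to the
   [B]-end of the other; the order is not known, hence the disjunction. *)
have seesE e g : sees e g ->
    E (ends e).1 (ends g).2 || E (ends g).1 (ends e).2.
  move=> /andP[_ /orP[/andP[_ /meet[|]]|]].
  - by move=> ->; rewrite endsE.
  - by move=> <-; rewrite endsE.
  move=> /existsP[h /andP[/andP[_ /meet he] /andP[_ /meet hg]]].
  case: he hg => he [] hg.
  - by rewrite -he hg endsE.
  - by rewrite -he -hg endsE.
  - by rewrite -he -hg endsE orbT.
  - by rewrite -he hg endsE orbT.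
have cardK : #|{: 'I_Delta * 'I_3}| = 3 * Delta.
  by rewrite card_prod !card_ord mulnC.
rewrite /strong_chromatic_index; case: ex_minnP => n _; apply.
apply/existsP; exists [ffun e => cast_ord cardK (enum_rank (col (ends e).1 (ends e).2))].
apply/forallP => e; apply/forallP => g; apply/implyP => seg; rewrite !ffunE.
have neg : ends e != ends g.
  by have /andP[ne _] := seg; apply: contraNneq ne => /ends_inj->.
rewrite (inj_eq (@cast_ord_inj _ _ _)) (inj_eq enum_rank_inj).
have [Eeg|Ege] := orP (seesE e g seg).
  by apply: colP => //; rewrite -!surjective_pairing.
by rewrite eq_sym colP // -!surjective_pairing eq_sym.
Qed.
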